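(* Let $f$ be a positive real-valued function on the positive integers such that $f(k) \to \infty$ as $k \to \infty$ (the divergence may be arbitrarily slow), and let $N^{+}(k) = 2^{k/2} k^{3/2} f(k)$. Then the probability that a $2$-coloring of $\{1,2,\ldots,N^{+}(k)\}$, chosen uniformly at random, contains a monochromatic $k$-term arithmetic progression approaches $1$ as $k \to \infty$.
   Context: For a real number $x > 0$, $\{1,2,\ldots,x\}$ denotes the set of all integers $m$ with $1 \le m \le x$. A $2$-coloring of a finite set $X$ is a function from $X$ to a fixed two-element set of colors; ''chosen uniformly at random'' means each of the $2^{|X|}$ colorings is equally likely. A $k$-term arithmetic progression ($k$-AP) in $X$ is a set $\{a, a+d, \ldots, a+(k-1)d\} \subseteq X$ with $a$ an integer and $d$ a positive integer (the common difference). It is monochromatic under a coloring if all its elements receive the same color. *)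

(* Defs.v *)
From HB Require Import structures.
From mathcomp Require Import all_boot all_order all_algebra finmap.
From mathcomp Require Import all_classical all_reals all_analysis.

Set Implicit Arguments.
Unset Strict Implicit.
Unset Printing Implicit Defensive.

Import Order.TTheory GRing.Theory Num.Theory.
Import numFieldNormedType.Exports.

Local Open Scope fset_scope.
Local Open Scope ring_scope.

(* The integers m with 1 <= m <= x, for a real bound x; see [in_upto]. *)
Definition upto (R : realType) (x : R) : {fset nat} :=
  [fset m in iota 1 (Num.truncn x)].

Lemma in_upto (R : realType) (x : R) (m : nat) :
  (m \in upto x) = (1 <= m)%N && (m%:R <= x).
Proof.
rewrite /upto !inE /= mem_iota add1n ltnS.
case: m => [|m] //=.
have [x0|x0] := leP 0 x; first by rewrite truncn_ge_nat.
rewrite (_ : Num.truncn x = 0%N); last by apply/truncn0Pn; rewrite -ltNge (lt_trans x0).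
by apply/esym/negbTE; rewrite -ltNge (lt_le_trans x0).
Qed.

Definition coloring (X : {fset nat}) := {ffun X -> bool}.

Definition ap (k a d : nat) : {fset nat} :=
  [fset (a + i * d)%N | i in iota 0 k].

(* The first term may be taken in nat rather than int: the ambient sets X are
   sets of naturals and, for 0 < k, the first term belongs to X. *)
Definition is_kAP (X : {fset nat}) (k : nat) (P : {fset nat}) : Prop :=
  P `<=` X /\ exists a d : nat, (0 < d)%N /\ P = ap k a d.

Definition monochromatic (X : {fset nat}) (c : coloring X) (P : {fset nat}) :
    Prop :=
  exists color : bool, forall x : X, val x \in P -> c x = color.

Definition has_mono_kAP (X : {fset nat}) (k : nat) (c : coloring X) : Prop :=
  exists P : {fset nat}, is_kAP X k P /\ monochromatic c P.

(* Uniform probability, over the colorings of X, of the event E. *)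
Definition coloring_prob (R : realType) (X : {fset nat})
    (E : coloring X -> Prop) : R :=
  #|[set c : coloring X | `[< E c >]]|%:R / #|{: coloring X}|%:R.

Definition Nplus (R : realType) (f : nat -> R) (k : nat) : R :=
  2 `^ (k%:R / 2) * k%:R `^ (3 / 2) * f k.

(* Main.v *)
(* Put t = floor(N / k^2), and consider the k-term progressions with difference
   d = t k - s (s < t) and first term r + 1 (r < t (k - 1)); they all lie in
   {1, ..., N}. The differences are so close to each other that two such
   progressions share at most one point, so the events that they are
   monochromatic are pairwise independent. By Chebyshev, none of them is
   monochromatic with probability at most 1 / E, where
   E = t^2 (k - 1) 2^(1-k) is the expected number of monochromatic ones, and
   E >= f(k) / 4 once f(k) >= 1, by the choice of N. *)
Require Import Defs.
From HB Require Import structures.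
From mathcomp Require Import all_boot all_order all_algebra finmap.
From mathcomp Require Import all_classical all_reals all_analysis.
From mathcomp Require Import ring lra zify.

Set Implicit Arguments.
Unset Strict Implicit.
Unset Printing Implicit Defensive.

Import Order.TTheory GRing.Theory Num.Theory.
Import numFieldNormedType.Exports.

Local Open Scope ring_scope.

(** * Chebyshev's inequality as a counting statement *)

(** Let [X c] count the sets [A i] that contain [c], with mean [m]. Summed over all [c], the squared
    deviation from [m] is at most [m * #|T|], and each [c] outside all [A i] contributes [m ^+ 2] to
    it. *)
Lemma card_avoid_le (R : realFieldType) (T I : finType) (A : I -> {set T})
    (p : R) :
  0 <= p -> (forall i, #|A i|%:R = p * #|T|%:R) ->
  (forall i j, i != j -> #|A i :&: A j|%:R <= p ^+ 2 * #|T|%:R) ->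
  #|[set c | [forall i, c \notin A i]]|%:R * (#|I|%:R * p) <= #|T|%:R :> R.
Proof.
move=> p0 cardA cardAI; set Z := [set c | _]; set m := #|I|%:R * p.
have m0 : 0 <= m by rewrite mulr_ge0.
have cardE (B : {set T}) : #|B|%:R = \sum_c (c \in B)%:R :> R.
  by rewrite -sum1_card natr_sum big_mkcond; apply: eq_bigr => c _; case: ifP.
pose X c : R := \sum_i (c \in A i)%:R.
have sumX : \sum_c X c = m * #|T|%:R.
  rewrite exchange_big /= (eq_bigr (fun=> p * #|T|%:R)); last first.
    by move=> i _; rewrite -cardE cardA.
  by rewrite sumr_const /m -mulrA mulr_natl.
have sumX2 : \sum_c X c ^+ 2 <= m * #|T|%:R + m ^+ 2 * #|T|%:R.
  have -> : \sum_c X c ^+ 2 = \sum_i \sum_j #|A i :&: A j|%:R.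
    under eq_bigr => c _ do rewrite expr2 big_distrlr.
    rewrite exchange_big; apply: eq_bigr => i _.
    rewrite exchange_big; apply: eq_bigr => j _ /=.
    by rewrite cardE; apply: eq_bigr => c _; rewrite inE -mulnb natrM.
  (* The diagonal term is exact; the others number at most [#|I|] and obey the hypothesis on
     pairs. *)
  have le_row i : \sum_j #|A i :&: A j|%:R <=
      p * #|T|%:R + #|I|%:R * (p ^+ 2 * #|T|%:R).
    rewrite (bigD1 i) //= finset.setIid cardA lerD2l.
    apply: le_trans (_ : \sum_(j | j != i) p ^+ 2 * #|T|%:R <= _).
      by apply: ler_sum => j ji; apply: cardAI; rewrite eq_sym.
    rewrite sumr_const -[leLHS]mulr_natl ler_wpM2r ?ler_nat ?max_card //.
    by rewrite mulr_ge0 ?sqr_ge0.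
  apply: le_trans (ler_sum _ (fun i _ => le_row i)) _.
  by rewrite sumr_const -[leLHS]mulr_natl /m; lra.
have lower : #|Z|%:R * m ^+ 2 <= \sum_c (X c - m) ^+ 2.
  rewrite cardE mulr_suml; apply: ler_sum => c _.
  rewrite inE; case: forallP => [cA|_]; last by rewrite mul0r sqr_ge0.
  have -> : X c = 0 by apply: big1 => i _; rewrite (negbTE (cA i)).
  by rewrite mul1r sub0r sqrrN.
have upper : \sum_c (X c - m) ^+ 2 <= m * #|T|%:R.
  have -> : \sum_c (X c - m) ^+ 2 =
      \sum_c X c ^+ 2 - 2 * m * \sum_c X c + m ^+ 2 * #|T|%:R.
    rewrite mulr_sumr -sumrB mulr_natr -sumr_const -big_split /=.
    by apply: eq_bigr => c _; ring.
  rewrite sumX; lra.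
(* One factor [m] gets cancelled, so [m = 0] is treated apart. *)
have [->|mn0] := eqVneq m 0; first by rewrite mulr0.
have mp : 0 < m by rewrite lt_def mn0.
rewrite -(ler_pM2l mp); apply: le_trans upper.
by apply: le_trans lower; lra.
Qed.

(** * Counting colorings that are constant on given sets *)

(** The values off [S] are free. The multiplied form avoids truncated subtraction in the
    exponent. *)
Lemma card_agree (X : finType) (S : {set X}) (g : X -> bool) :
  (#|[set c : {ffun X -> bool} | [forall x in S, c x == g x]]| * 2 ^ #|S|
    = 2 ^ #|X|)%N.
Proof.
pose F x : pred bool := if x \in S then pred1 (g x) else predT.
have -> : #|[set c : {ffun X -> bool} | [forall x in S, c x == g x]]| =
    #|family F|.
  apply: eq_card => c; rewrite inE; apply/forall_inP/familyP => cg x.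
    by rewrite /F; case: ifP => // /cg.
  by move=> xS; have := cg x; rewrite /F xS.
rewrite card_family foldrE big_map big_enum /=.
rewrite -(cardsC S) expnD mulnC; congr (_ * _)%N.
rewrite -prod_nat_const (bigID (mem S)) /= big1 => [|x xS]; last first.
  by rewrite /F xS card1.
rewrite mul1n; apply: eq_big => [x|x xS]; first by rewrite inE.
by rewrite /F (negbTE xS) card_bool.
Qed.

Definition mono_on (X : finType) (S : {set X}) : {set {ffun X -> bool}} :=
  [set c : {ffun X -> bool} | [exists b, [forall x in S, c x == b]]].

(** A point of [S] makes the two classes, one for each color, disjoint, so their sizes add up. *)
Lemma card_mono_on (X : finType) (S : {set X}) :
  (0 < #|S|)%N -> (#|mono_on S| * 2 ^ #|S| = 2 * 2 ^ #|X|)%N.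
Proof.
move=> /card_gt0P[x0 x0S].
pose B b := [set c : {ffun X -> bool} | [forall x in S, c x == b]].
have -> : mono_on S = B true :|: B false.
  apply/setP => c; rewrite !inE; apply/existsP/orP => [[[]]|[]];
    by [left|right|exists true|exists false].
rewrite cardsU (_ : _ :&: _ = finset.set0) ?cards0 ?subn0.
  by rewrite mulnDl !card_agree mul2n addnn.
apply/setP => c; rewrite !inE; apply/negP.
move=> /andP[/forall_inP cT /forall_inP cF].
by have := cT _ x0S; rewrite (eqP (cF _ x0S)).
Qed.

(** If the sets are disjoint, the two colors are chosen independently, which gives four patterns on
    the union. If they share one point, the colors agree and the union is monochromatic; it has one
    point less than [#|S1| + #|S2|], which turns the factor 2 into 4. *)
Lemma card_mono_onI (X : finType) (S1 S2 : {set X}) :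
  (#|S1 :&: S2| <= 1)%N ->
  (#|mono_on S1 :&: mono_on S2| * 2 ^ (#|S1| + #|S2|) <= 4 * 2 ^ #|X|)%N.
Proof.
have cardU := cardsUI S1 S2.
case: (posnP #|S1 :&: S2|) cardU => [/eqP|/card_gt0P[x]].
  rewrite cards_eq0 => /eqP S0; rewrite S0 cards0 addn0 => <- _.
  pose B b1 b2 := [set c : {ffun X -> bool} |
    [forall x in S1 :|: S2, c x == if x \in S1 then b1 else b2]].
  have sub : mono_on S1 :&: mono_on S2 \subset
      (B true true :|: B true false) :|: (B false true :|: B false false).
    have inB (c : {ffun X -> bool}) b1 b2 : [forall x in S1, c x == b1] ->
        [forall x in S2, c x == b2] -> c \in B b1 b2.
      move=> /forall_inP c1 /forall_inP c2; rewrite inE; apply/forall_inP => x.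
      by rewrite inE; case: ifP => [/c1|_ /c2].
    apply/fintype.subsetP => c; rewrite finset.in_setI [c \in mono_on S1]inE.
    rewrite [c \in mono_on S2]inE.
    case/andP => /existsP[b1 c1] /existsP[b2 c2]; rewrite !finset.in_setU.
    by have := inB _ _ _ c1 c2; case: b1 b2 {c1 c2} => [] [] ->; rewrite ?orbT.
  have le : (#|mono_on S1 :&: mono_on S2| <=
      #|B true true| + #|B true false| + (#|B false true| + #|B false false|))%N.
    apply: leq_trans (subset_leq_card sub) _.
    by apply: leq_trans (leq_add _ _); exact: leq_card_setU.
  apply: leq_trans (leq_mul le (leqnn _)) _.
  by rewrite !mulnDl !card_agree; lia.
move=> xI cardU le1.
have {le1} I1 : #|S1 :&: S2| = 1%N.
  by apply/eqP; rewrite eqn_leq le1; apply/card_gt0P; exists x.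
move: xI; rewrite inE => /andP[x1 x2].
have sub : mono_on S1 :&: mono_on S2 \subset mono_on (S1 :|: S2).
  apply/fintype.subsetP => c; rewrite !inE.
  case/andP => /existsP[b1 /forall_inP c1] /existsP[b2 /forall_inP c2].
  have b12 : b2 = b1 by rewrite -(eqP (c1 _ x1)) (eqP (c2 _ x2)).
  apply/existsP; exists b1; apply/forall_inP => y; rewrite inE => /orP[/c1//|/c2].
  by rewrite b12.
rewrite -cardU I1 addn1 expnS mulnCA.
have := @card_mono_on _ (S1 :|: S2); have := subset_leq_card sub.
have -> : (0 < #|S1 :|: S2|)%N by apply/card_gt0P; exists x; rewrite inE x1.
move=> le /(_ isT) eq.
have : (#|mono_on S1 :&: mono_on S2| * 2 ^ #|S1 :|: S2| <= 2 * 2 ^ #|X|)%N.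
  by rewrite -eq leq_mul2r le orbT.
by lia.
Qed.

(** * A family of progressions meeting pairwise in at most one point *)

Lemma mem_ap (k a d m : nat) :
  reflect (exists2 j, (j < k)%N & m = (a + j * d)%N) (m \in ap k a d).
Proof.
rewrite /ap; apply: (iffP (imfsetP _ _ _ _)) => [[j]|[j jk ->]].
  by rewrite /= mem_iota => /andP[_ jk] ->; exists j.
by exists j => //=; rewrite mem_iota.
Qed.

Lemma card_ap (k a d : nat) : (0 < d)%N -> #|` ap k a d| = k.
Proof.
move=> d0; rewrite card_imfset /=; last first.
  by move=> i j /eqP; rewrite eqn_add2l eqn_pmul2r // => /eqP.
by rewrite undup_id ?iota_uniq // size_iota.
Qed.

(** All differences exceed [t * (k - 1)], hence every offset [r] in the second index. *)
Definition fam_diff (k t : nat) (i : 'I_t * 'I_(t * k.-1)) : nat :=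
  (t * k - i.1)%N.

Definition fam_ap (k t : nat) (i : 'I_t * 'I_(t * k.-1)) : {fset nat} :=
  ap k i.2.+1 (fam_diff i).

Lemma fam_diff_gt0 (k t : nat) (i : 'I_t * 'I_(t * k.-1)) : (0 < fam_diff i)%N.
Proof. by case: i => [[s st] [r rt]]; rewrite /fam_diff /=; nia. Qed.

(** The last term is at most [t * (k - 1) + (k - 1) * (t * k)]. *)
Lemma fam_ap_le (k t : nat) (i : 'I_t * 'I_(t * k.-1)) (m : nat) :
  m \in fam_ap i -> (0 < m <= t * k ^ 2)%N.
Proof.
case: i => [[s st] [r rt]] /mem_ap[j jk ->]; rewrite /fam_diff /=.
rewrite addSn /=.
by have := leq_mul (leq_subr s (t * k)) (leqnn j); nia.
Qed.

(* Two shared points at distance [i * d = j * d'] with [d' < d] force [i < j],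
   hence [i * (d - d') >= d'], but [i <= k - 2],
   [d - d' < t] and [d' > t * (k - 1)]. *)
Lemma fam_apI (k t : nat) (i1 i2 : 'I_t * 'I_(t * k.-1)) (m n : nat) :
  m \in fam_ap i1 -> m \in fam_ap i2 ->
  n \in fam_ap i1 -> n \in fam_ap i2 -> i1 != i2 -> (m < n)%N -> False.
Proof.
wlog le12 : i1 i2 / (i2.1 <= i1.1)%N.
  move=> wl m1 m2 n1 n2 i12.
  case: (leqP i2.1 i1.1) => [/wl|/ltnW/wl]; first exact.
  by apply=> //; rewrite eq_sym.
case: i1 i2 le12 => [[s1 st1] [r1 rt1]] [[s2 st2] [r2 rt2]] /= s21.
move=> /mem_ap[a ak ->] /mem_ap[b bk /= e1] /mem_ap[c ck ->] /mem_ap[d dk /= e2].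
move=> ne ltmn; move: e1 e2 ltmn; rewrite /fam_diff /=.
move: s21; rewrite leq_eqVlt => /predU1P[s12 | lt21].
  have [r12|r12] := eqVneq (r1 : nat) r2.
    by case/eqP: ne; congr pair; apply: val_inj.
  (* With a common difference, the offsets are congruent modulo it and both smaller than it, hence
     equal. *)
  rewrite s12 !addSn => -[e1] _ _; case/eqP: r12.
  have r1d : (r1 < t * k - s1)%N by nia.
  have r2d : (r2 < t * k - s1)%N by nia.
  by move: e1 => /(congr1 (modn^~ (t * k - s1)%N));
    rewrite addnC modnMDl addnC modnMDl !modn_small.
set d1 := (t * k - s1)%N; set d2 := (t * k - s2)%N => e1 e2 ltmn.
have lac : (a < c)%N by nia.
have lbd : (b < d)%N by nia.
have eij : ((d - b) * d2 = (c - a) * d1)%N by rewrite !mulnBl; lia.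
have ltij : (d - b < c - a)%N.
  by rewrite ltnNge; apply/negP => le; have := leq_mul le (leqnn d1); nia.
have d12 : (d1 <= (d - b) * (d2 - d1))%N.
  by rewrite mulnBr eij -mulnBl leq_pmull // subn_gt0.
have : (d1 <= (k - 2) * t)%N by apply: leq_trans d12 (leq_mul _ _); lia.
by rewrite /d1; nia.
Qed.

(** * From the family to a lower bound on the probability *)

Lemma card_trace (X A : {fset nat}) :
  (A `<=` X)%fset -> #|[set x : X | val x \in A]| = #|` A|.
Proof.
move=> /fsubsetP AX; set S := [set x : X | _].
have -> : A = [fset val x | x in S]%fset.
  apply/fsetP => m; apply/idP/imfsetP => [mA|[x + ->]]; last by rewrite /= inE.
  by exists [` AX _ mA]%fset; rewrite //= inE.
by rewrite card_imfset /=; [rewrite cardE|exact: val_inj].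
Qed.

Lemma coloring_prob_le1 (R : realType) (X : {fset nat})
    (E : coloring X -> Prop) :
  coloring_prob R E <= 1.
Proof.
rewrite /coloring_prob ler_pdivrMr ?mul1r ?ler_nat ?max_card //.
by rewrite ltr0n card_ffun card_bool expn_gt0.
Qed.

(** [X] contains the whole family, so [card_avoid_le] applies with [p = 2 / 2 ^+ k]: the colorings
    that leave every member non-monochromatic form a fraction at most the inverse of the mean. *)
Lemma coloring_prob_mono_ge (R : realType) (X : {fset nat}) (k t : nat) :
  (1 < k)%N -> (0 < t)%N ->
  (forall m, (0 < m <= t * k ^ 2)%N -> m \in X) ->
  1 - ((t * (t * k.-1))%:R * (2 / 2 ^+ k))^-1 <=
    coloring_prob R (@has_mono_kAP X k).
Proof.
move=> k1 t0 subX; pose I := ('I_t * 'I_(t * k.-1))%type.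
pose S (i : I) := [set x : X | val x \in fam_ap i].
have apX (i : I) : (fam_ap i `<=` X)%fset.
  by apply/fsubsetP => m /fam_ap_le/subX.
have cardS i : #|S i| = k by rewrite card_trace // card_ap // fam_diff_gt0.
have cardT : #|{: coloring X}| = (2 ^ #|{: X}|)%N.
  by rewrite card_ffun card_bool.
have cardT0 : 0 < #|{: coloring X}|%:R :> R by rewrite ltr0n cardT expn_gt0.
have k2 : 2 ^+ k != 0 :> R by rewrite expf_neq0.
have p0 : 0 <= 2 / 2 ^+ k :> R by rewrite divr_ge0 ?exprn_ge0.
have SI i j : i != j -> (#|S i :&: S j| <= 1)%N.
  move=> ij; apply/card_le1_eqP => x y; rewrite !inE.
  move=> /andP[xi xj] /andP[yi yj]; apply: val_inj.
  case: (ltngtP (val x) (val y)) => // lt; exfalso.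
    exact: (fam_apI xi xj yi yj ij lt).
  exact: (fam_apI yi yj xi xj ij lt).
pose Z := [set c : coloring X | [forall i, c \notin mono_on (S i)]].
have leZ : #|Z|%:R * ((t * (t * k.-1))%:R * (2 / 2 ^+ k)) <=
    #|{: coloring X}|%:R :> R.
  have -> : (t * (t * k.-1))%N = #|{: I}| by rewrite card_prod !card_ord.
  apply: card_avoid_le p0 _ _ => [i|i j ij]; rewrite cardT.
    have := @card_mono_on _ (S i); rewrite cardS => /(_ (ltnW k1)) e.
    apply: (mulIf k2); rewrite -natrX -natrM e natrM natrX.
    by field.
  have := card_mono_onI (SI _ _ ij); rewrite !cardS => le.
  have k4 : 0 < 2 ^+ (k + k) :> R by rewrite exprn_gt0.
  rewrite -(ler_pM2r k4) -[X in _ * X <= _]natrX -natrM.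
  apply: le_trans (_ : (4 * 2 ^ #|{: X}|)%:R <= _); first by rewrite ler_nat.
  by rewrite natrM exprD le_eqVlt; apply/orP; left; apply/eqP; field.
rewrite /coloring_prob; set E := [set c | _].
(* A coloring outside [Z] has a monochromatic member of the family, so it lies in [E]. *)
have leE : (#|{: coloring X}| <= #|E| + #|Z|)%N.
  rewrite -(cardsC Z) addnC leq_add2r.
  apply/subset_leq_card/fintype.subsetP => c.
  rewrite !inE negb_forall => /existsP[i]; rewrite negbK inE.
  case/existsP => b /forall_inP cb.
  exists (fam_ap i); split.
    by split=> //; exists i.2.+1, (fam_diff i); rewrite fam_diff_gt0.
  by exists b => x xi; apply/eqP/cb; rewrite inE.
have m0 : 0 < (t * (t * k.-1))%:R * (2 / 2 ^+ k) :> R.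
  by rewrite mulr_gt0 ?divr_gt0 ?exprn_gt0 // ltr0n !muln_gt0 t0 -subn1 subn_gt0.
move: leE; rewrite -(ler_nat R) natrD => leE.
have {}leZ : #|Z|%:R <=
    ((t * (t * k.-1))%:R * (2 / 2 ^+ k))^-1 * #|{: coloring X}|%:R :> R.
  by rewrite mulrC ler_pdivlMr.
rewrite ler_pdivlMr // mulrBl mul1r lerBlDr.
by apply: le_trans leE _; rewrite lerD2l.
Qed.

(** * Size of the expected count *)

(** Squaring clears the half-integer exponents. *)
Lemma Nplus_sqr (R : realType) (f : nat -> R) (k : nat) :
  Nplus f k ^+ 2 = 2 ^+ k * k%:R ^+ 3 * f k ^+ 2.
Proof.
rewrite /Nplus !exprMn; congr (_ * _ * _);
  by rewrite -[LHS]powR_mulrn ?powR_ge0 // -powRrM mulfVK ?pnatr_eq0 //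
    powR_mulrn.
Qed.

(** Rounding costs constants only: [y <= 2 * t] and [k <= 2 * (k - 1)], so
    [2 ^+ k * f k ^+ 2 = y ^+ 2 * k] is at most [8 * t ^+ 2 * (k - 1)]. The mean is then at least
    [f k ^+ 2 / 4]. *)
Lemma family_mean_ge (R : realType) (f : nat -> R) (k : nat) :
  (1 < k)%N -> 1 <= f k ->
  let t := Num.truncn (Nplus f k / k%:R ^+ 2) in
  (0 < t)%N /\ f k / 4 <= (t * (t * k.-1))%:R * (2 / 2 ^+ k).
Proof.
move=> k1 f1; set y := Nplus f k / _ => t.
have k0 : 0 < k%:R :> R by rewrite ltr0n ltnW.
have kk : k%:R <= 2 ^+ k :> R by rewrite -natrX ler_nat ltnW // ltn_expl.
have q0 : 0 < 2 ^+ k :> R by rewrite exprn_gt0.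
have y0 : 0 <= y.
  by rewrite divr_ge0 ?exprn_ge0 // !mulr_ge0 ?powR_ge0 // (le_trans _ f1).
have y2 : y ^+ 2 * k%:R = 2 ^+ k * f k ^+ 2.
  by rewrite expr_div_n Nplus_sqr; field; rewrite gt_eqF.
(* This keeps [t] from being zero; it follows from [k <= 2 ^+ k] and [1 <= f k]. *)
have y1 : 1 <= y.
  rewrite -(ler_pXn2r (n := 2)) ?nnegrE // expr1n -(ler_pM2r k0) y2 mul1r.
  by apply: le_trans kk _; rewrite ler_peMr ?exprn_ege1 // ltW.
have t0 : (0 < t)%N by rewrite truncn_ge_nat.
split=> //.
have /andP[_ yt] := truncn_itv y0; rewrite -/t in yt.
have yt2 : y <= 2 * t%:R.
  by apply: le_trans (ltW yt) _;
    rewrite -natr1 mulr2n mulrDl mul1r lerD2l ler1n.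
have kk1 : k%:R <= 2 * k.-1%:R :> R.
  by rewrite -natrM ler_nat; clear -k1; lia.
have : y ^+ 2 * k%:R <= (2 * t%:R) ^+ 2 * (2 * k.-1%:R).
  by apply: ler_pM; rewrite ?sqr_ge0 ?ler_pXn2r ?nnegrE // mulr_ge0.
rewrite y2 => le.
rewrite mulrA ler_pdivlMr // !natrM.
have : f k * 2 ^+ k <= 2 ^+ k * f k ^+ 2.
  by rewrite mulrC ler_pM2l // expr2 ler_peMr // (le_trans _ f1).
lra.
Qed.

(** * Passage to the limit *)

Local Open Scope classical_set_scope.

Theorem theorem1 (R : realType) (f : nat -> R)
  (f_pos : forall k : nat, (0 < k)%N -> 0 < f k)
  (f_div : f k @[k --> \oo] --> +oo) :
  coloring_prob R (@has_mono_kAP (upto (Nplus f k)) k) @[k --> \oo] --> (1 : R).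
Proof.
have f4 : (fun k => (f k / 4)^-1) k @[k --> \oo] --> (0 : R).
  apply/gtr0_cvgV0.
    by exists 1%N => // k /= k0; rewrite divr_gt0 // f_pos.
  apply/cvgryPge => A; move/cvgryPge: f_div => /(_ (A * 4)).
  by apply: filterS => k; rewrite ler_pdivlMr.
have lim1 : (fun k => 1 - (f k / 4)^-1) k @[k --> \oo] --> (1 : R).
  by rewrite -[X in _ --> X]subr0; apply: cvgB => //; exact: cvg_cst.
(* The probability is eventually squeezed between [1 - 4 / f k] and 1. *)
apply: (squeeze_cvgr _ lim1 (cvg_cst (1 : R))).
have f1 : \forall k \near \oo, 1 <= f k by move/cvgryPge: f_div; exact.
near=> k.
have k1 : (1 < k)%N by near: k; exact: nbhs_infty_gt.
have fk1 : 1 <= f k by near: k.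
have [t0 mean] := family_mean_ge k1 fk1.
set t := Num.truncn _ in t0 mean.
rewrite coloring_prob_le1 andbT.
have ge := @coloring_prob_mono_ge R (upto (Nplus f k)) k t k1 t0.
apply: le_trans (ge _); last first.
  (* The family fits because [t <= Nplus f k / k ^+ 2]. *)
  move=> m /andP[m0 mt]; rewrite in_upto m0 /=.
  have kk : 0 < k%:R ^+ 2 :> R by rewrite exprn_gt0 // ltr0n ltnW.
  apply: le_trans (_ : (t * k ^ 2)%:R <= _); first by rewrite ler_nat.
  rewrite natrM natrX -ler_pdivlMr //.
  have y0 : 0 <= Nplus f k / k%:R ^+ 2.
    by rewrite divr_ge0 ?mulr_ge0 ?powR_ge0 ?(le_trans _ fk1) // ltW.
  by have /andP[] := truncn_itv y0.
have fk0 : 0 < f k by rewrite f_pos // ltnW.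
rewrite lerD2l lerN2 lef_pV2 ?posrE ?divr_gt0 //.
by apply: lt_le_trans mean; rewrite divr_gt0.
Unshelve. all: by end_near.
Qed.
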